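(* For integers $n \ge 1$ let $A_n = \frac{1}{2}\sqrt{n}$, and for integers $M \ge 1$ let $$S(M) := \sum_{n=M^2}^{M^2+2M} A_n .$$ Then $$\lim_{M\to\infty} \frac{S(M+1)}{S(M)} = 1 .$$
   Context: Here $A_n$ is the area of the $n$-th right-angled triangle of the Square Root Spiral (spiral of Theodorus), which has legs of lengths $\sqrt n$ and $1$; thus $S(M)$ is the area of the part of the spiral lying between the rays of lengths $M=\sqrt{M^2}$ and $M+1=\sqrt{(M+1)^2}$ belonging to consecutive square numbers. *)

(* Defs.v *)
From Stdlib Require Import Reals.
From Coquelicot Require Import Coquelicot.
Open Scope R_scope.

Definition triangle_area (n : nat) : R := 1 / 2 * sqrt (INR n).

(* [sum_n_m a p q] includes both endpoints: a p + ... + a q. *)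
Definition spiral_area (M : nat) : R :=
  sum_n_m triangle_area (M ^ 2) (M ^ 2 + 2 * M).

(* Main.v *)
Require Import Defs.
From Stdlib Require Import Reals Lia Lra.
From Coquelicot Require Import Coquelicot.
Open Scope R_scope.

(** The strip of the spiral between the rays of lengths [M] and [M + 1] consists
    of [2 * M + 1] triangles, and the long leg [sqrt n] of each of them lies
    between [M] and [M + 1].  Hence
    [(2 * M + 1) * M / 2 <= spiral_area M <= (2 * M + 1) * (M + 1) / 2].
    The upper bound for [M] does not exceed the lower bound for [M + 1], so the
    ratio of consecutive areas is at least [1]; and the bounds the other way
    round make it at most
    [(2 * M + 3) / (2 * M + 1) * ((M + 2) / M) <= (1 + 2 / M) ^ 2].
    This tends to [1], and the ratio is squeezed. *)

Lemma sum_n_m_bounds (a : nat -> R) (lo hi : R) (p q : nat) :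
  (forall n, (p <= n <= q)%nat -> lo <= a n <= hi) ->
  INR (S q - p) * lo <= sum_n_m a p q <= INR (S q - p) * hi.
Proof.
  intros Ha.
  rewrite <- !sum_n_m_const.
  (* [sum_n_m_le] compares summands at every index, so [a] is replaced by a
     sequence that agrees with it on the range and equals the bound elsewhere. *)
  pose (extend := fun c n =>
    if andb (Nat.leb p n) (Nat.leb n q) then a n else c : R).
  assert (Hext : forall c, sum_n_m a p q = sum_n_m (extend c) p q).
  { intros c. apply sum_n_m_ext_loc. intros n [Hp Hq]. unfold extend.
    apply Nat.leb_le in Hp, Hq. now rewrite Hp, Hq. }
  split; [rewrite (Hext lo) | rewrite (Hext hi)];
    apply sum_n_m_le; intros n; unfold extend;
    destruct (Nat.leb_spec p n), (Nat.leb_spec n q); simpl;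
    solve [apply Rle_refl | apply Ha; lia].
Qed.

Lemma triangle_area_bounds (M n : nat) :
  (M ^ 2 <= n <= M ^ 2 + 2 * M)%nat ->
  INR M / 2 <= triangle_area n <= (INR M + 1) / 2.
Proof.
  intros [Hlo Hhi].
  pose proof (pos_INR M) as HM.
  assert (Hhi' : (n <= (M + 1) ^ 2)%nat) by (simpl in *; lia).
  apply le_INR in Hlo, Hhi'.
  rewrite pow_INR in Hlo, Hhi'. rewrite plus_INR in Hhi'. simpl INR in Hhi'.
  apply sqrt_le_1_alt in Hlo, Hhi'.
  rewrite sqrt_pow2 in Hlo, Hhi' by lra.
  unfold triangle_area. lra.
Qed.

Lemma spiral_area_bounds (M : nat) :
  (2 * INR M + 1) * INR M / 2 <= spiral_area M
    <= (2 * INR M + 1) * (INR M + 1) / 2.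
Proof.
  pose proof (sum_n_m_bounds triangle_area _ _ _ _ (triangle_area_bounds M)) as H.
  replace (S (M ^ 2 + 2 * M) - M ^ 2)%nat with (2 * M + 1)%nat in H by lia.
  rewrite plus_INR, mult_INR in H. simpl INR in H.
  unfold spiral_area. lra.
Qed.

Lemma spiral_area_ratio_bounds (M : nat) :
  (1 <= M)%nat ->
  1 <= spiral_area (M + 1) / spiral_area M <= (1 + 2 / INR M) * (1 + 2 / INR M).
Proof.
  intros HM.
  pose proof (spiral_area_bounds M) as [Hlo Hhi].
  pose proof (spiral_area_bounds (M + 1)) as [Hlo' Hhi'].
  rewrite plus_INR in Hlo', Hhi'. simpl (INR 1) in Hlo', Hhi'.
  apply le_INR in HM. simpl in HM.
  set (x := INR M) in *.
  assert (Hpos : 0 < spiral_area M) by nra.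
  split.
  - apply Rle_div_r; nra.
  - apply Rle_div_l; [exact Hpos|].
    apply Rle_trans with (1 := Hhi').
    apply Rle_trans with
      ((1 + 2 / x) * (1 + 2 / x) * ((2 * x + 1) * x / 2)).
    + replace ((1 + 2 / x) * (1 + 2 / x) * ((2 * x + 1) * x / 2))
        with ((x + 2) / 2 * ((x + 2) * (2 * x + 1) / x)) by (field; lra).
      replace ((2 * (x + 1) + 1) * (x + 1 + 1) / 2)
        with ((x + 2) / 2 * (2 * x + 3)) by field.
      apply Rmult_le_compat_l; [lra|].
      apply Rle_div_r; nra.
    + apply Rmult_le_compat_l; [apply Rle_0_sqr | exact Hlo].
Qed.

Lemma is_lim_seq_one_plus_two_div_INR :
  is_lim_seq (fun M : nat => 1 + 2 / INR M) 1.
Proof.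
  replace (Finite 1) with (Finite (1 + 2 * 0)) by (f_equal; ring).
  apply is_lim_seq_plus'; [apply is_lim_seq_const|].
  apply is_lim_seq_mult'; [apply is_lim_seq_const|].
  exact (is_lim_seq_inv _ _ is_lim_seq_INR ltac:(discriminate)).
Qed.

Theorem proposition1 :
  is_lim_seq (fun M : nat => spiral_area (M + 1) / spiral_area M) (Finite 1).
Proof.
  apply is_lim_seq_le_le_loc with
    (u := fun _ => 1) (w := fun M => (1 + 2 / INR M) * (1 + 2 / INR M)).
  - exists 1%nat. exact spiral_area_ratio_bounds.
  - apply is_lim_seq_const.
  - replace (Finite 1) with (Finite (1 * 1)) by (f_equal; ring).
    apply is_lim_seq_mult'; apply is_lim_seq_one_plus_two_div_INR.
Qed.
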